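(* Let $\Gamma=\{X_n\}_{n\in\mathbb N_0}$ be a conditionally difference-bounded ranking supermartingale adapted to a filtration $\{\mathcal F_n\}_{n\in\mathbb N_0}$. Suppose that (i) for every $n\in\mathbb N_0$ and all $\omega$, $X_n(\omega)=0$ implies $X_{n+1}(\omega)=0$, and (ii) there exists $\delta\in(0,\infty)$ such that for all $n\in\mathbb N_0$, almost surely $$\mathbb E(X_{n+1}\mid\mathcal F_n)\ge X_n-\delta\cdot\mathbf 1_{X_n>0}.$$ Then $\mathbb E(Z_\Gamma)\ge\dfrac{\mathbb E(X_0)}{\delta}$.
   Context: All random variables live on a probability space $(\Omega,\mathcal F,\mathbb P)$; $\mathbb N_0$ is the set of nonnegative integers. A process $\{X_n\}_{n\in\mathbb N_0}$ adapted to a filtration $\{\mathcal F_n\}_{n\in\mathbb N_0}$ is a ranking supermartingale if there is $\epsilon\in(0,\infty)$ such that for all $n\in\mathbb N_0$: $\mathbb E(|X_n|)<\infty$; $X_n\ge0$ a.s.; and $\mathbb E(X_{n+1}\mid\mathcal F_n)\le X_n-\epsilon\cdot\mathbf 1_{X_n>0}$ a.s. It is conditionally difference-bounded if there is $c\in(0,\infty)$ such that for all $n$: $\mathbb E(|X_{n+1}-X_n|)<\infty$ and $\mathbb E(|X_{n+1}-X_n|\mid\mathcal F_n)\le c$ a.s. The stopping time $Z_\Gamma$ is $Z_\Gamma(\omega):=\min\{n\in\mathbb N_0: X_n(\omega)\le0\}$, with $\min\emptyset:=\infty$. *)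

(* Defs.v *)
From HB Require Import structures.
From mathcomp Require Import all_boot all_order all_algebra.
From mathcomp Require Import all_classical all_reals all_analysis.

Set Implicit Arguments.
Unset Strict Implicit.
Unset Printing Implicit Defensive.

Import Order.TTheory GRing.Theory Num.Theory.
Import numFieldNormedType.Exports.

Local Open Scope classical_set_scope.
Local Open Scope ring_scope.

Section processes.
Context {d : measure_display} {T : measurableType d} {R : realType}.
Variable P : probability T R.

Implicit Types (G : set (set T)) (F : nat -> set (set T)).
Implicit Types (Y C : T -> R) (X : nat -> T -> R).

(* The sigma-algebra of [g_sigma_algebraType G] is the one generated by [G],
   which is [G] itself when [G] is a sigma-algebra. *)
Definition measurable_wrt G Y : Prop :=
  measurable_fun [set: g_sigma_algebraType G] (Y : g_sigma_algebraType G -> R).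

Definition filtration F : Prop :=
  forall n, [/\ sigma_algebra [set: T] (F n),
                F n `<=` measurable & F n `<=` F n.+1].

Definition adapted F X : Prop := forall n, measurable_wrt (F n) (X n).

Definition integrable_rv Y : Prop := P.-integrable [set: T] (EFin \o Y).

(* [C] is a version of the conditional expectation of [Y] given [G]. It is
   meant for an integrable [Y] and a sub-sigma-algebra [G], in which case
   versions exist and are a.s. unique; an a.s. (in)equality about E(Y | G) is
   then rendered as the existence of a version that satisfies it. *)
Definition is_cond_exp G Y C : Prop :=
  [/\ measurable_wrt G C, integrable_rv C &
      forall A, G A -> (\int[P]_(w in A) (C w)%:E = \int[P]_(w in A) (Y w)%:E)%E].

Definition ranking_supermartingale F X : Prop :=
  exists2 eps : R, 0 < eps & forall n : nat,
    [/\ integrable_rv (X n),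
        {ae P, forall w, 0 <= X n w} &
        exists2 C, is_cond_exp (F n) (X n.+1) C &
          {ae P, forall w, C w <= X n w - eps * \1_[set v | 0 < X n v] w}].

Definition cond_difference_bounded F X : Prop :=
  exists2 c : R, 0 < c & forall n : nat,
    integrable_rv (fun w => `|X n.+1 w - X n w|) /\
    exists2 C, is_cond_exp (F n) (fun w => `|X n.+1 w - X n w|) C &
      {ae P, forall w, C w <= c}.

Definition termination_time X (w : T) : \bar R :=
  if pselect (exists n, X n w <= 0) is left ex then (ex_minn ex)%:R%:E
  else +oo%E.

End processes.

(* Main.v *)
(* Absorption makes {Z > n} almost surely equal to {X_n > 0}, so E Z is the sum
   of the p_n = P(X_n > 0); only the case E Z < +oo matters. Telescoping (ii)
   gives E X_0 <= E X_n + delta * E Z for every n, so it is enough that E X_n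
   tends to 0. By Borel-Cantelli almost every path hits 0, so X_n is bounded by
   the sum over k >= n of |X_{k+1} - X_k|. The k-th increment vanishes off
   {X_k > 0}, an event of F_k, and therefore has expectation at most c * p_k;
   hence E X_n is at most c times a tail of the convergent series of the p_k. *)
Require Import Defs.
From HB Require Import structures.
From mathcomp Require Import all_boot all_order all_algebra.
From mathcomp Require Import all_classical all_reals all_analysis.
From mathcomp Require Import measurable_realfun.
Import Order.TTheory GRing.Theory Num.Theory.
Import numFieldNormedType.Exports.
Local Open Scope classical_set_scope.
Local Open Scope ring_scope.

(** The failures lie in a measurable null set [N]; both integrals are unchanged on [D] minus [N],
    where the inequality is pointwise. Integrability stands in for a sign condition. *)
Lemma ae_le_integral {d : measure_display} {T : measurableType d}
    {R : realType} (mu : {measure set T -> \bar R}) (D : set T)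
    (f g : T -> \bar R) :
  measurable D -> mu.-integrable D f -> mu.-integrable D g ->
  {ae mu, forall x, D x -> (f x <= g x)%E} ->
  (\int[mu]_(x in D) f x <= \int[mu]_(x in D) g x)%E.
Proof.
move=> mD intf intg [N [mN N0 leN]].
have mDN : measurable (D `\` N) by exact: measurableD.
have subD : D `\` N `<=` D by move=> x [].
rewrite (negligible_integral mN mD intf N0) (negligible_integral mN mD intg N0).
apply: le_integral; [exact: mDN| | |].
- exact: integrableS intf.
- exact: integrableS intg.
- move=> x; rewrite inE => -[Dx Nx]; apply: contrapT => nle.
  by apply/Nx/leN => /(_ Dx).
Qed.

Lemma nneseries_cst1 (R : realType) : (\sum_(0 <= k <oo) 1 = +oo :> \bar R)%E.
Proof.
apply: eq_infty => r.
apply: le_trans (nneseries_lim_ge (Num.trunc r).+1 _); last by [].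
by rewrite sumEFin sumr_const_nat subn0 lee_fin ltW// truncnS_gt.
Qed.

Section measurable_wrt.
Context {d : measure_display} {T : measurableType d} {R : realType}.
Variable P : probability T R.
Implicit Types (G : set (set T)) (Y C : T -> R).

Lemma measurable_wrt_gt0 G Y : sigma_algebra [set: T] G ->
  measurable_wrt G Y -> G [set w | 0 < Y w].
Proof.
move=> sG mY.
have := mY measurableT `]0, +oo[%classic (measurable_itv _).
by rewrite setTI preimage_itvoy /measurable /= sigma_algebra_id.
Qed.

Lemma sigma_algebra_setT G : sigma_algebra [set: T] G -> G [set: T].
Proof. by move=> [G0 GC _]; rewrite -(setD0 [set: T]); exact: GC. Qed.

(** As [Y] vanishes almost surely off [A], its integral is the one over [A]. Since [A] belongs to
    [G], [Y] can be replaced there by [C], which is at most [c]. *)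
Lemma integral_cond_exp_le_measure G Y C A (c : R) :
  G `<=` measurable -> G A -> integrable_rv P Y -> is_cond_exp P G Y C ->
  {ae P, forall w, C w <= c} -> {ae P, forall w, ~ A w -> Y w = 0} ->
  (\int[P]_w (Y w)%:E <= c%:E * P A)%E.
Proof.
move=> Gm GA intY [_ intC CY] Cc Y0.
have mA := Gm _ GA.
rewrite (@ae_eq_integral _ _ _ P setT ((EFin \o Y) \_ A)) //; first last.
- apply: filterS Y0 => w Yw _ /=; rewrite patchE.
  by case: ifPn => // /negP; rewrite inE => /Yw ->.
- apply: (@measurable_int _ _ _ P); rewrite -integrable_mkcond//.
  exact: integrableS intY.
- exact: measurable_int intY.
rewrite -integral_mkcond /comp -(CY _ GA) -(integral_cst P mA c%:E).
apply: ae_le_integral => //.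
- exact: integrableS intC.
- exact: (finite_measure_integrable_cst P c mA).
- by apply: filterS Cc => w Cw _; rewrite lee_fin.
Qed.

End measurable_wrt.

Section absorbed_path.
Context {T : Type} {R : realType}.
Implicit Types (X : nat -> T -> R) (w : T).

Lemma absorbedW X w (absorbX : forall n, X n w = 0 -> X n.+1 w = 0) m n :
  (m <= n)%N -> X m w = 0 -> X n w = 0.
Proof. by move=> /subnK <- Xm0; elim: (n - m)%N => // k /absorbX. Qed.

(** Telescoping from [n] up to a zero at [m], then the triangle inequality. The shift by [n] makes
    the series start at 0, ready for exchanging sum and integral. *)
Lemma le_nneseries_increments X w n :
  (exists2 m, (n <= m)%N & X m w = 0) ->
  (`|X n w|%:E <= \sum_(0 <= k <oo) `|X (k + n).+1 w - X (k + n)%N w|%:E)%E.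
Proof.
move=> [m nm Xm0].
rewrite (@nneseries_addn _ (fun k => `|X k.+1 w - X k w|%:E))//.
apply: le_trans (nneseries_lim_ge m _); last by move=> *; rewrite lee_fin.
rewrite sumEFin lee_fin.
have -> : X n w = - \sum_(n <= k < m) (X k.+1 w - X k w).
  by rewrite (telescope_sumr (fun k => X k w))// Xm0 sub0r opprK.
by rewrite normrN ler_norm_sum.
Qed.

End absorbed_path.

(** The k-th indicator is 1 exactly when k lies before the first hit. Asking for positivity at all
    times up to k makes this hold for every path, with neither sign nor absorption assumed. *)
Lemma termination_timeE {d : measure_display} {T : measurableType d}
    {R : realType} (X : nat -> T -> R) w :
  (termination_time X w =
   \sum_(0 <= k <oo) (\1_[set v | forall j, (j <= k)%N -> (0 < X j v)%R] w)%:E)%E.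
Proof.
rewrite /termination_time; case: pselect => [ex|nex].
  case: ex_minnP => m Xm mmin.
  rewrite (nneseries_split _ m); last by move=> *; rewrite lee_fin.
  rewrite add0n [X in (_ + X)%E]eseries0 ?adde0; last first.
    move=> k mk _; rewrite indicE memNset// => /(_ _ mk).
    by rewrite ltNge Xm.
  rewrite sumEFin -[in LHS](subn0 m) -sumr_const_nat; congr (_%:E).
  apply: eq_big_nat => k /andP[_ km]; rewrite indicE mem_set// => j jk.
  rewrite ltNge; apply/negP => /mmin; rewrite leqNgt.
  by rewrite (leq_ltn_trans jk km).
rewrite -[LHS](nneseries_cst1 R); apply: eq_eseriesr => k _.
rewrite indicE mem_set// => j _; rewrite ltNge; apply/negP => Xj.
by apply: nex; exists j.
Qed.

(** Sum and integral are exchanged by nonnegativity. A nonnegative path that is positive at time n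
    was never 0 before, by absorption, so staying positive up to n amounts almost surely to
    [0 < X n w]. *)
Lemma integral_termination_time {d : measure_display} {T : measurableType d}
    {R : realType} (P : probability T R) (X : nat -> T -> R) :
  (forall n, measurable [set w | 0 < X n w]) ->
  (forall n w, X n w = 0 -> X n.+1 w = 0) ->
  {ae P, forall w, forall n, 0 <= X n w} ->
  (\int[P]_w termination_time X w =
   \sum_(0 <= n <oo) P [set w | (0 < X n w)%R])%E.
Proof.
move=> mX absorbX X0.
pose A := fun n => [set w | forall j, (j <= n)%N -> 0 < X j w].
have mA n : measurable (A n).
  have -> : A n = \bigcap_(j in [set j | (j <= n)%N]) [set w | 0 < X j w] by [].
  exact: bigcap_measurableType.
rewrite (eq_integral (fun w => \sum_(0 <= n <oo) (\1_(A n) w)%:E)%E); last first.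
  by move=> w _; exact: termination_timeE.
rewrite integral_nneseries//; last first.
  by move=> n; exact/measurable_EFinP.
apply: eq_eseriesr => n _; rewrite -[RHS]expectation_indic// unlock.
apply: ae_eq_integral => //; [by exact/measurable_EFinP..|].
apply: filterS X0 => w Xw _; congr (_%:E).
rewrite !indicE; congr ((nat_of_bool _)%:R).
apply/idP/idP; rewrite !inE /A /=; first by move=> /(_ n (leqnn _)).
move=> Xn j jn; rewrite lt_neqAle Xw andbT eq_sym; apply: contraTneq Xn => Xj0.
by rewrite (absorbedW X w (absorbX ^~ w) j n jn Xj0) ltxx.
Qed.

Theorem proposition2 (d : measure_display) (T : measurableType d)
  (R : realType) (P : probability T R)
  (F : nat -> set (set T)) (X : nat -> T -> R)
  (filtF : filtration F) (adaptX : adapted F X)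
  (rsmX : ranking_supermartingale P F X)
  (diffX : cond_difference_bounded P F X)
  (absorbX : forall (n : nat) (w : T), X n w = 0 -> X n.+1 w = 0)
  (delta : R) (delta_gt0 : 0 < delta)
  (lowerX : forall n : nat,
    exists2 C : T -> R, is_cond_exp P (F n) (X n.+1) C &
      {ae P, forall w, X n w - delta * \1_[set v | 0 < X n v] w <= C w}) :
  ('E_P[X 0%N] / delta%:E <= \int[P]_w termination_time X w)%E.
Proof.
have FX n : F n [set w | 0 < X n w].
  by have [sF _ _] := filtF n; exact: measurable_wrt_gt0.
have mX n : measurable [set w | 0 < X n w].
  by have [_ Fm _] := filtF n; exact/Fm/FX.
have intX n : integrable_rv P (X n) by have [? _ /(_ n)[]] := rsmX.
have X_ge0 : {ae P, forall w, forall n, 0 <= X n w}.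
  by apply: ae_foralln => n; have [? _ /(_ n)[]] := rsmX.
set S := (\int[P]_w termination_time X w)%E.
set p := fun n => P [set w | 0 < X n w].
have SE : S = (\sum_(0 <= n <oo) p n)%E by exact: integral_termination_time.
rewrite inver (gt_eqF delta_gt0) lee_pdivrMr// unlock.
have [Soo|Soo] := eqVneq S +oo%E; first by rewrite Soo gt0_mulye ?lte_fin// leey.
have S_ge0 : (0 <= S)%E by rewrite SE; apply: nneseries_ge0.
have S_fin : S \is a fin_num by rewrite ge0_fin_numE// lt_neqAle Soo leey.
(* Hypothesis (ii) integrated over the whole space, which belongs to [F n], so [C] and [X n.+1] have
   the same integral. *)
have one_step n : (\int[P]_w (X n w)%:E <=
    \int[P]_w (X n.+1 w)%:E + delta%:E * p n)%E.
  have [C [_ intC CX] leC] := lowerX n.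
  have [sF _ _] := filtF n.
  rewrite -(CX _ (sigma_algebra_setT _ sF)) /p -expectation_indic// unlock.
  rewrite -integralZl//; last exact: integrable_indic.
  rewrite -integralD//; last by apply: integrableZl => //; exact: integrable_indic.
  apply: ae_le_integral => //.
  - exact: intX.
  - apply: integrableD => //; apply: integrableZl => //; exact: integrable_indic.
  - by apply: filterS leC => w leCw _; rewrite -EFinM -EFinD lee_fin -lerBlDr.
have telescope n : (\int[P]_w (X 0%N w)%:E <=
    \int[P]_w (X n w)%:E + delta%:E * \sum_(0 <= k < n) p k)%E.
  elim: n => [|n IH]; first by rewrite big_nil mule0 adde0.
  apply: le_trans IH _; rewrite big_nat_recr//= muleDr//; last first.
    by rewrite ge0_adde_def// inE// sume_ge0.
  by rewrite (addeC (_ * _)%E) addeA leeD2r.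
have [c c_gt0 diffc] := diffX.
have increment k : (\int[P]_w (`|X k.+1 w - X k w|)%:E <= c%:E * p k)%E.
  have [intD [C expC leC]] := diffc k; have [_ Fm _] := filtF k.
  apply: integral_cond_exp_le_measure (FX k) intD expC leC _ => //.
  apply: filterS X_ge0 => w Xw /negP; rewrite -leNgt => Xk.
  have Xk0 : X k w = 0 by apply/eqP; rewrite eq_le Xk Xw.
  by rewrite Xk0 (absorbX _ _ Xk0) subrr normr0.
have ae_absorbed : {ae P, forall w, exists m, X m w = 0}.
  (* Borel-Cantelli applies because the [p n] sum to the finite [S]. *)
  have P0 : P (lim_sup_set (fun n => [set w | 0 < X n w])) = 0.
    by apply: lim_sup_set_cvg0 => //; rewrite -/S -SE ltey.
  have : {ae P, forall w, ~ lim_sup_set (fun n => [set w | 0 < X n w]) w}.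
    exists (lim_sup_set (fun n => [set w | 0 < X n w])); split => //.
    - by apply: bigcap_measurableType => n _; apply: bigcup_measurable => k _.
    - by move=> w /contrapT.
  apply: filterS2 X_ge0 => w Xw infX; apply: contrapT => noX.
  (* A nonnegative path without zeros is positive at every time, so it lies in the limsup, each [n]
     being its own witness. *)
  apply: infX => n _; exists n => //=; rewrite lt_neqAle Xw andbT eq_sym.
  by apply/eqP => Xn0; apply: noX; exists n.
have tail n : (\int[P]_w (X n w)%:E <= c%:E * \sum_(n <= k <oo) p k)%E.
  have mD k : measurable_fun setT (fun w => (`|X k.+1 w - X k w|)%:E).
    by have [/(measurable_int P) + _] := diffc k.
  (* With the absolute value both sides of the next comparison are nonnegative everywhere, so the
     series of increments need not be known integrable. *)
  apply: (@le_trans _ _ (\int[P]_w (`|X n w|)%:E)%E).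
    apply: ae_le_integral => //; first exact: intX.
    - exact: integrable_abse (intX n).
    - by apply: aeW => w _; rewrite lee_fin ler_norm.
  apply: (@le_trans _ _ (\int[P]_w
      \sum_(0 <= k <oo) `|X (k + n).+1 w - X (k + n)%N w|%:E)%E).
    apply: ae_ge0_le_integral => //.
    - exact: measurable_int (integrable_abse (intX n)).
    - by move=> w _; apply: nneseries_ge0.
    - by apply: ge0_emeasurable_sum.
    - apply: filterS ae_absorbed => w [m Xm0] _; apply: le_nneseries_increments.
      (* The zero at [m] may come before [n]; absorption carries it to [m + n]. *)
      exists (m + n)%N; first exact: leq_addl.
      exact: absorbedW (absorbX ^~ w) _ _ (leq_addr _ _) Xm0.
  rewrite integral_nneseries//.
  rewrite -(@nneseries_addn _ p)// -nneseriesZl//.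
  by apply: lee_nneseries => k *; [exact: integral_ge0|exact: increment].
(* The tails of the convergent series of the [p k] vanish, so the bound on the expectation of [X 0]
   tends to [delta%:E * S]. *)
have p_cvg : (c%:E * (\sum_(n <= k <oo) p k) + delta%:E * S @[n --> \oo]
    --> c%:E * 0 + delta%:E * S)%E.
  apply: cvgeD; first by rewrite mule0 fin_num_adde_defr.
    by apply: cvgeZl => //; apply: nneseries_tail_cvg => //; rewrite -SE ltey.
  exact: cvg_cst.
rewrite mule0 add0e in p_cvg.
rewrite muleC; apply: (cvge_to_ge p_cvg); apply: nearW => n.
apply: le_trans (telescope n) _; apply: leeD (tail n) _.
by rewrite lee_pmul2l ?lte_fin// SE; apply: nneseries_lim_ge.
Qed.
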